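(* Let $n_1, n_2, \ldots, n_t$ be a sequence of sufficiently large integers, of which $t_e$ are even and $t_o$ are odd. Let $c=82\times 35^{2^{t_o}-2}\times 81^{t_e}$ and $n=\max(n_1,\dots,n_t)$, and suppose that for all $i$ we have $n_i\geq 2\lceil \log (nc) \rceil+2$. Then $$\hat{R}(C_{n_1},\ldots,C_{n_t})\leq (\ln c+1)\,c^2\, n.$$
   Context: $C_k$ denotes the cycle on $k$ vertices. For graphs $G_1,\ldots,G_k$, the size-Ramsey number $\hat{R}(G_1,\ldots,G_k)$ is the smallest integer $m$ for which there exists a graph $H$ with $m$ edges such that for every coloring of the edges of $H$ with colors $1,\ldots,k$ there is, for some $i$, a copy of $G_i$ in $H$ all of whose edges have color $i$. $\log$ denotes the logarithm to base $2$ and $\ln$ the natural logarithm. *)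

(* Defs.v *)
From Stdlib Require Import Reals ZArith.
From mathcomp Require Import all_boot.
Set Implicit Arguments. Unset Strict Implicit. Unset Printing Implicit Defensive.

Definition simple_graph (V : finType) (e : rel V) : Prop :=
  (forall x y, e x y = e y x) /\ (forall x, e x x = false).

Definition edges (V : finType) (e : rel V) : {set {set V}} :=
  [set [set x; y] | x in V, y in V & e x y].

Definition num_edges (V : finType) (e : rel V) : nat := #|edges e|.

(* A t-colouring of the edges of H: a symmetric colour function on pairs
   (its values on non-edges are irrelevant). *)
Definition edge_colouring (V : finType) (t : nat) (col : V -> V -> 'I_t) : Prop :=
  forall x y, col x y = col y x.

Definition mono_cycle (V : finType) (e : rel V) (t : nat) (col : V -> V -> 'I_t)
    (k : nat) (i : 'I_t) : Prop :=
  exists f : 'I_k -> V, injective f /\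
    forall j : 'I_k, e (f j) (f (ordS j)) /\ col (f j) (f (ordS j)) = i.

Definition arrows_cycles (V : finType) (e : rel V) (t : nat) (ns : 'I_t -> nat) : Prop :=
  forall col : V -> V -> 'I_t, edge_colouring col ->
    exists i : 'I_t, mono_cycle e col (ns i) i.

(* hat R(C_{n_1},...,C_{n_t}) <= x  (as a real bound):
   there is a simple graph with at most x edges arrowing the cycles;
   this is exactly "the least such number of edges is <= x". *)
Definition size_ramsey_cycles_le (t : nat) (ns : 'I_t -> nat) (x : R) : Prop :=
  exists (V : finType) (e : rel V), simple_graph e /\ arrows_cycles e ns /\
    Rle (INR (num_edges e)) x.

Definition Rlog2 (x : R) : R := Rdiv (ln x) (ln 2).
Definition Rceil (x : R) : Z := (- Int_part (- x))%Z.

Definition num_even (t : nat) (ns : 'I_t -> nat) : nat := #|[set i | ~~ odd (ns i)]|.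
Definition num_odd (t : nat) (ns : 'I_t -> nat) : nat := #|[set i | odd (ns i)]|.

(* c = 82 * 35^(2^{t_o} - 2) * 81^{t_e}  (exponent may be -1 when t_o = 0) *)
Definition const_c (t : nat) (ns : 'I_t -> nat) : R :=
  Rmult (Rmult (IZR 82) (powerRZ (IZR 35) (Z.sub (Z.of_nat (2 ^ num_odd ns)) 2%Z))) (pow (IZR 81) (num_even ns)).

Definition max_n (t : nat) (ns : 'I_t -> nat) : nat := \max_(i < t) ns i.

(* Main.v *)
Require Import Defs.
From Stdlib Require Import Reals ZArith Lra Classical_Prop.
From mathcomp Require Import all_boot zify.
Set Implicit Arguments. Unset Strict Implicit. Unset Printing Implicit Defensive.

(** Call two disjoint vertex sets with no edge in between a hole. The host graph has [F n]
    vertices, no hole formed by two [n]-sets, and about [2 F^2 (ln F + 1) n] edges; it is built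
    greedily, each new edge killing a proportion [1 / F^2] of the remaining pairs of [n]-sets.

    Fix a colouring without the required cycles. If a colour has no [m]-hole between [A] and [B],
    both of size at least [21 m], then there are [m]-sets [L1], [L2] on opposite sides such that
    every [u] in [L1] is joined to every [v] in [L2] by a path of one prescribed length: reserve
    two expanding subgraphs, take a long path in the rest by depth-first search, and let each of
    its two ends grow by doubling into its own reserve up to size [m]. An edge between [L1] and
    [L2] closes an even cycle, and a common neighbour in a third set [C] closes an odd one.

    So an even colour can be avoided between subsets of [A] and [B], at the cost of a factor [21],
    and an odd colour between subsets of two of any three sets. Three sets avoiding [k] odd colours
    pairwise come from applying the result for [k] colours twice, whence the doubly exponential
    recursion [odd_factor (k + 1) = 21 * odd_factor k ^ 2]. Once all colours are avoided, a hole
    of two [n]-sets is left, which is absurd. *)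

(** * Linking in bipartite graphs without large holes *)

Lemma exists_subset_card (T : finType) (A : {set T}) k : k <= #|A| ->
  exists2 B : {set T}, B \subset A & #|B| = k.
Proof.
case/card_geqP => s [us <- sA]; exists [set x in s]; last by rewrite cardsE; exact/card_uniqP.
by apply/subsetP => x; rewrite inE; exact: sA.
Qed.

Lemma disjoint_setDl (T : finType) (A B : {set T}) : [disjoint A :\: B & B].
Proof. by rewrite disjoint_subset; apply/subsetP => x; rewrite !inE => /andP[]. Qed.

Lemma disjoint_seq_sub (T : finType) (A B : {set T}) (s1 s2 : seq T) :
  {subset s1 <= A} -> {subset s2 <= B} -> [disjoint A & B] -> [disjoint s1 & s2].
Proof. by move=> s1A s2B dAB; apply: disjointW dAB; apply/subsetP. Qed.

Section BipartiteLinking.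
Variables (V : finType) (r : rel V) (S : bool -> {set V}) (m : nat).
Hypothesis rsym : symmetric r.
Hypothesis Sdisj : forall b x, x \in S b -> x \notin S (~~ b).
Hypothesis rbip : forall b x y, x \in S b -> r x y -> y \in S (~~ b).
Hypothesis m_gt0 : 0 < m.
Hypothesis rich : forall b (X Y : {set V}), X \subset S b -> Y \subset S (~~ b) ->
  m <= #|X| -> m <= #|Y| -> exists x y, [/\ x \in X, y \in Y & r x y].

Definition nbrs (X : {set V}) := [set y | [exists x in X, r x y]].

Lemma nbrsP (X : {set V}) y : reflect (exists2 x, x \in X & r x y) (y \in nbrs X).
Proof. by rewrite inE; exact: exists_inP. Qed.

Lemma card_non_nbrs b (X T : {set V}) : X \subset S b -> T \subset S (~~ b) ->
  m <= #|X| -> #|T :\: nbrs X| < m.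
Proof.
move=> XS TS mX; rewrite ltnNge; apply/negP => mT.
have [|x [y [xX]]] := rich XS _ mX mT; first exact: subset_trans (subsetDl _ _) TS.
by rewrite !inE => /andP[/existsP nex _] rxy; case: nex; exists x; rewrite xX.
Qed.

(** The factor 3 is what doubling costs: after the fewer than [#|X|] vertices already used are
    discarded, at least [2 * #|X|] new neighbours remain. *)
Definition expanding (C : bool -> {set V}) := forall b (X : {set V}),
  X \subset C b -> #|X| <= m -> 3 * #|X| <= #|nbrs X :&: C (~~ b)|.

Lemma nbrsU (X Y : {set V}) : nbrs (X :|: Y) = nbrs X :|: nbrs Y.
Proof.
apply/setP => y; rewrite in_setU; apply/nbrsP/orP => [[x]|].
  by rewrite inE => /orP[xX|xY] rxy; [left|right]; apply/nbrsP; exists x.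
by case=> /nbrsP[x xX rxy]; exists x; rewrite // inE xX ?orbT.
Qed.

(* The core is what remains after deleting a largest non-expanding pair of small sets. *)
Lemma expanding_core (T : bool -> {set V}) :
    (forall b, T b \subset S b) -> (forall b, 8 * m <= #|T b|) ->
  exists C : bool -> {set V}, [/\ forall b, C b \subset T b,
    forall b, 7 * m <= #|C b| & expanding C].
Proof.
move=> TS mT.
pose inv (Z : {ffun bool -> {set V}}) := [forall b, [&& Z b \subset T b, #|Z b| < m &
  #|nbrs (Z b) :&: (T (~~ b) :\: Z (~~ b))| <= 3 * #|Z b|]].
have inv0 : inv [ffun=> set0].
  apply/forallP => b; rewrite !ffunE sub0set cards0 m_gt0 /=.
  suff -> : nbrs set0 = set0 by rewrite set0I cards0.
  by apply/setP => y; rewrite in_set0; apply/negP => /nbrsP[x]; rewrite inE.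
case: (arg_maxnP (fun Z : {ffun bool -> {set V}} => #|Z true| + #|Z false|) inv0).
move=> Z invZ maxZ; move/forallP: (invZ) => invZb.
have cT b : 7 * m <= #|T b :\: Z b|.
  case/and3P: (invZb b) => ZT Zm _; move: (mT b).
  by rewrite cardsD (setIidPr ZT); lia.
exists (fun b => T b :\: Z b); split=> // [b|b X XC Xm].
  exact: subsetDl.
rewrite leqNgt; apply/negP => Xbad.
case/and3P: (invZb b) => ZT Zm Znb.
have XT : X \subset T b by apply: subset_trans XC (subsetDl _ _).
have XZ : [disjoint X & Z b].
  by apply: disjointWl XC _; exact: disjoint_setDl.
have cU : #|Z b :|: X| = #|Z b| + #|X|.
  by rewrite cardsU setIC (disjoint_setI0 XZ) cards0 subn0.
have nU : #|nbrs (Z b :|: X) :&: (T (~~ b) :\: Z (~~ b))| <= 3 * #|Z b :|: X|.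
  rewrite nbrsU setIUl cU mulnDr.
  by apply: leq_trans (leq_card_setU _ _) (leq_add Znb (ltnW Xbad)).
have UT : Z b :|: X \subset T b by rewrite subUset ZT.
(* With [m] or more vertices, [Z b :|: X] would miss fewer than [m] of the [7 * m] vertices left
   opposite and so have more than [6 * m] neighbours there, while [nU] allows fewer than [6 * m]. *)
have cUm : #|Z b :|: X| < m.
  rewrite ltnNge; apply/negP => mU.
  have := card_non_nbrs (subset_trans UT (TS b))
    (subset_trans (subsetDl (T (~~ b)) (Z (~~ b))) (TS _)) mU.
  rewrite cardsD [_ :&: nbrs _]setIC; move: Zm Xm (cT (~~ b)) nU; rewrite cU; move: (#|Z b|) (#|X|) (#|_ :\: _|) (#|_ :&: _|); lia.
pose Z' := [ffun b' => if b' == b then Z b :|: X else Z b'].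
have invZ' : inv Z'.
  apply/forallP => b'; rewrite !ffunE.
  have [->|nb] := eqVneq b' b.
    by rewrite UT cUm; case: (b) nU => /=.
  have -> : b = ~~ b' by move: nb; case: (b) (b') => [] [].
  have -> : (~~ b' == ~~ b') by [].
  case/and3P: (invZb b') => -> -> /= H; apply: leq_trans H.
  apply: subset_leq_card; rewrite setIS // setDS //.
  have -> : ~~ b' = b by move: nb; case: (b) (b') => [] [].
  exact: subsetUl.
have Xpos : 0 < #|X| by case: (#|X|) Xbad.
have := maxZ _ invZ'; rewrite /Z' !ffunE.
by move: cU; clear - Xpos; case: b => /= ->; lia.
Qed.

(** A tree grows from [x] through [z]: [Y] is its current layer of leaves and [U] holds all vertices
    used after [x]. Each layer doubles, so the earlier ones together stay smaller than the last. *)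
Lemma layers (C : bool -> {set V}) (b : bool) (x z : V) :
    (forall b, C b \subset S b) -> expanding C -> z \in C b -> r x z ->
  forall i, 2 ^ i <= 2 * m -> exists Y U : {set V},
    [/\ Y \subset C (b (+) odd i), Y \subset U & U \subset C true :|: C false] /\
    [/\ #|Y| = 2 ^ i, #|U :\: Y| < 2 ^ i & forall y, y \in Y -> exists p,
        [/\ path r x p, last x p = y, size p = i.+1, uniq p & {subset p <= U}]].
Proof.
move=> CS exC zC rxz; elim=> [|i IH] le2m.
  exists [set z], [set z]; rewrite addbF setDv cards0 cards1 sub1set; split.
    by split=> //; rewrite sub1set inE; case: (b) zC => ->; rewrite ?orbT.
  split=> // y /set1P->; by exists [:: z]; split; rewrite /= ?rxz // => u; rewrite !inE.
have [|Y [U [[YC YU UC] [cY cU reach]]]] := IH; first by move: le2m; rewrite expnS; lia.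
have Ym : #|Y| <= m by move: le2m; rewrite cY expnS; lia.
pose c := b (+) odd i.
have N3 : 3 * #|Y| <= #|nbrs Y :&: C (~~ c)| := exC _ _ YC Ym.
pose A := (nbrs Y :&: C (~~ c)) :\: U.
have cA : 2 ^ i.+1 <= #|A|.
  (* [Y] and its neighbours lie on opposite sides, so a neighbour already used is in [U :\: Y]. Of
     at least [3 * 2 ^ i] neighbours fewer than [2 ^ i] are lost. *)
  have AU : nbrs Y :&: C (~~ c) :&: U \subset U :\: Y.
    apply/subsetP => u; rewrite !inE => /andP[/andP[_ uC] ->]; rewrite andbT.
    apply/negP => uY; have /(subsetP (CS _)) := subsetP YC _ uY.
    by move/Sdisj; rewrite (subsetP (CS _)).
  have := subset_leq_card AU; rewrite /A [#|_ :\: U|]cardsD -/c.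
  move: N3 cU; rewrite cY expnS; clear; lia.
have [Y' Y'A cY'] := exists_subset_card cA.
have dY'U : [disjoint Y' & U].
  by apply: disjointWl Y'A _; exact: disjoint_setDl.
have Y'C : Y' \subset C (~~ c).
  by apply: subset_trans Y'A _; rewrite /A; apply: subset_trans (subsetDl _ _) (subsetIr _ _).
exists Y', (U :|: Y'); split.
  split; first by rewrite /= addbN.
    exact: subsetUr.
  rewrite subUset UC (subset_trans Y'C) //; case: (~~ c); [exact: subsetUl|exact: subsetUr].
split=> // [|y' y'Y'].
  have -> : (U :|: Y') :\: Y' = U.
    rewrite setDUl setDv setU0; apply/setDidPl; by rewrite disjoint_sym.
  by rewrite -(cardsID Y U) (setIidPr YU) cY expnS; move: cU; clear; lia.
have := subsetP Y'A _ y'Y'; rewrite !inE => /andP[y'U /andP[/existsP[y /andP[yY ryy']] _]].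
have [p [pp lp sp up pU]] := reach y yY.
exists (rcons p y'); split.
- by rewrite rcons_path pp lp.
- by rewrite last_rcons.
- by rewrite size_rcons sp.
- by rewrite rcons_uniq up andbT; apply: contra y'U => /pU.
- move=> u; rewrite mem_rcons !inE => /orP[/eqP->|/pU->//]; by rewrite y'Y' orbT.
Qed.

Lemma long_path (M : bool -> {set V}) k :
    (forall b, M b \subset S b) -> (forall b, 2 * m + k <= #|M b|) -> 0 < k ->
  exists x p, [/\ path r x p, size p = k.-1, uniq (x :: p) &
                {subset x :: p <= M true :|: M false}].
Proof.
move=> MS cM k_gt0.
(* Depth-first search: [P] is the current path, [T] the exhausted and [U] the unvisited vertices. *)
have dfs (N : nat) (P : seq V) (T U : {set V}) : 2 * #|U| + size P <= N ->
    sorted r P -> uniq P -> {subset P <= M true :|: M false} -> size P <= k ->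
    (forall x, x \in M true :|: M false -> [|| x \in P, x \in T | x \in U]) ->
    U \subset M true :|: M false -> T \subset M true :|: M false ->
    [disjoint P & U] -> (forall x y, x \in T -> y \in U -> ~~ r x y) ->
    (forall b, #|T :&: M b| < m) ->
    exists Q, [/\ sorted r Q, size Q = k, uniq Q & {subset Q <= M true :|: M false}].
  (* The measure [2 * #|U| + size P] drops by one both when a vertex moves from [U] to [P] and when
     one moves from [P] to [T]. *)
  elim: N P T U => [|N IH] P T U.
    rewrite leqn0 addn_eq0 muln_eq0 /= cards_eq0 => /andP[/eqP-> /eqP/size0nil->].
    move=> _ _ _ _ cov _ _ _ _ Tm; exfalso.
    have : M true \subset T :&: M true.
      by apply/subsetP => x xM; move: (cov x); rewrite !inE xM /= orbF => /(_ isT) ->.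
    move/subset_leq_card; move: (Tm true) (cM true); lia.
  move=> meas sP uP PM szP cov UM TM dPU nTU Tm.
  have [szk|szk] := eqVneq (size P) k; first by exists P.
  have {}szk : size P < k by rewrite ltn_neqAle szk.
  have extend u : u \in U -> sorted r (u :: P) ->
      exists Q, [/\ sorted r Q, size Q = k, uniq Q & {subset Q <= M true :|: M false}].
    move=> uU suP; apply: (IH (u :: P) T (U :\ u)) => //.
    - by move: meas; rewrite (cardsD1 u U) uU /=; lia.
    - by rewrite cons_uniq uP andbT; apply/negP => /(disjointFr dPU); rewrite uU.
    - by move=> x; rewrite inE => /orP[/eqP->|/PM//]; exact: (subsetP UM).
    - move=> x /cov; rewrite !inE; case: eqP => //= _; by case: (x \in P).
    - exact: subset_trans (subsetDl _ _) UM.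
    - rewrite disjoint_cons !inE eqxx /=; apply: disjointWr dPU; exact: subsetDl.
    - by move=> x y xT; rewrite !inE => /andP[_]; exact: nTU.
  case: P meas sP uP PM szP cov dPU szk extend => [|x P] meas sP uP PM szP cov dPU szk extend.
    have [U0|[u uU]] := set_0Vmem U; last exact: (extend u).
    exfalso; have : M true \subset T :&: M true.
      by apply/subsetP => x xM; move: (cov x); rewrite U0 !inE xM /= orbF => /(_ isT) ->.
    move/subset_leq_card; move: (Tm true) (cM true); lia.
  have [/existsP[u /andP[uU rxu]]|/existsPn nxU] := boolP [exists u, (u \in U) && r x u].
    by apply: (extend u) => //=; rewrite rsym rxu.
  have nT'U y z : y \in x |: T -> z \in U -> ~~ r y z.
    rewrite !inE => /orP[/eqP-> zU|yT zU]; last exact: nTU.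
    by have := nxU z; rewrite zU.
  apply: (IH P (x |: T) U) => //.
  - by move: meas => /=; lia.
  - exact: path_sorted sP.
  - by case/andP: uP.
  - by move=> y yP; apply: PM; rewrite inE yP orbT.
  - exact: ltnW.
  - move=> y /cov; rewrite !inE; by case: (y == x); rewrite /= ?orbT.
  - by rewrite subUset sub1set TM PM // mem_head.
  - by move: dPU; rewrite disjoint_cons => /andP[].
  move=> b; rewrite ltnNge; apply/negP => mT'.
  have T'm b' : #|(x |: T) :&: M b'| <= m.
    rewrite setIUl; apply: leq_trans (leq_card_setU _ _) _.
    apply: leq_trans (Tm b'); rewrite -addn1 addnC leq_add2l.
    by apply: leq_trans (subset_leq_card (subsetIl _ _)) _; rewrite cards1.
  (* Suppose the exhausted set reaches [m] on side [b]. Of the [2 * m + k] vertices opposite, fewer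
     than [k] are on the path and at most [m] exhausted, so [m] are unvisited, and [rich] yields a
     forbidden edge from exhausted to unvisited. *)
  have UMb : m <= #|U :&: M (~~ b)|.
    have sub : M (~~ b) \subset [set y in x :: P] :|: ((x |: T) :&: M (~~ b)) :|: (U :&: M (~~ b)).
      apply/subsetP => y yM; move: (cov y); rewrite !inE yM.
      have -> : (y \in M true) || (y \in M false) by case: (~~ b) yM => ->; rewrite ?orbT.
      by move/(_ isT)/or3P => [/orP[]| |] ->; rewrite ?orbT.
    have := subset_leq_card sub; have := T'm (~~ b); have := cM (~~ b).
    have := leq_of_leqif (leq_card_setU ([set y in x :: P] :|: ((x |: T) :&: M (~~ b))) (U :&: M (~~ b))).
    have := leq_of_leqif (leq_card_setU [set y in x :: P] ((x |: T) :&: M (~~ b))).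
    have : #|[set y in x :: P]| <= size (x :: P) by rewrite cardsE; exact: card_size.
    lia.
  have [||y [z [yT zU]]] := @rich b _ _ _ _ mT' UMb.
  - exact: subset_trans (subsetIr _ _) (MS b).
  - exact: subset_trans (subsetIr _ _) (MS _).
  apply/negP; move: yT zU; rewrite inE => /andP[yT _]; rewrite inE => /andP[zU _].
  exact: nT'U.
have [Q [sQ szQ uQ QM]] :
    exists Q, [/\ sorted r Q, size Q = k, uniq Q & {subset Q <= M true :|: M false}].
  apply: (dfs _ [::] set0 (M true :|: M false) (leqnn _)) => //.
  - by move=> x ->; rewrite !orbT.
  - exact: sub0set.
  - by apply/pred0P => x.
  - by move=> x y; rewrite inE.
  - by move=> b; rewrite set0I cards0.
case: Q sQ szQ uQ QM => [|x p] sQ szQ uQ QM; first by move: k_gt0; rewrite -szQ.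
by exists x, p; rewrite -szQ.
Qed.

Lemma path_side b x p : x \in S b -> path r x p -> last x p \in S (b (+) odd (size p)).
Proof.
elim: p b x => [|y p IH] b x xS /=; first by rewrite addbF.
by case/andP => rxy /(IH _ _ (rbip xS rxy)); rewrite addNb addbN.
Qed.

(** The bad vertices are those without a neighbour in the expanding core of [T]; the core is large,
    so [rich] makes them few. They are fixed before any path is chosen, so a path avoiding them can
    be extended at either end. *)
Lemma reservoir (T : bool -> {set V}) j :
    (forall b, T b \subset S b) -> (forall b, 8 * m <= #|T b|) -> 2 ^ j <= 2 * m ->
  exists Bad : bool -> {set V}, (forall b, #|Bad b| < m) /\
    forall b x, x \in S b -> x \notin Bad b -> exists Y : {set V},
      [/\ Y \subset S (~~ b (+) odd j), #|Y| = 2 ^ j & forall y, y \in Y -> exists p,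
        [/\ path r x p, last x p = y, size p = j.+1, uniq p &
            {subset p <= T true :|: T false}]].
Proof.
move=> TS cT jm; have [C [CT cC exC]] := expanding_core TS cT.
have CS b : C b \subset S b := subset_trans (CT b) (TS b).
exists (fun b => S b :\: nbrs (C (~~ b))); split=> [b|b x xS].
  apply: (@card_non_nbrs (~~ b)); rewrite ?negbK //.
  by apply: leq_trans (cC _); rewrite leq_pmull.
rewrite in_setD xS andbT negbK => /nbrsP[z zC]; rewrite rsym => rxz.
have [Y [U [[YC YU UC] [cY _ reach]]]] := layers CS exC zC rxz jm.
exists Y; split=> // [|y /reach[p [pp lp sp up pU]]].
  exact: subset_trans YC (CS _).
exists p; split=> // u /pU /(subsetP UC); rewrite !inE => /orP[] /(subsetP (CT _)) ->;
  by rewrite ?orbT.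
Qed.

(** The 21 splits as 8 + 8 + 5: two reserves for the trees and a middle part for the path. An odd
    [l] puts the ends of the path on opposite sides; trees of equal depth then have their leaves on
    opposite sides too. *)
Lemma linked_leaves j l : (forall b, 21 * m <= #|S b|) ->
    m <= 2 ^ j -> 2 ^ j <= 2 * m -> odd l -> l.+1 <= m ->
  exists b (L1 L2 : {set V}),
    [/\ L1 \subset S b, L2 \subset S (~~ b), m <= #|L1|, m <= #|L2| &
     forall u v, u \in L1 -> v \in L2 -> exists w,
       [/\ path r u w, last u w = v, size w = l + 2 * j.+1, uniq (u :: w) &
           {subset u :: w <= S true :|: S false}]].
Proof.
move=> cS mj jm oddl lm.
have splitS b : exists T1 T2 M : {set V}, [/\ T1 \subset S b, T2 \subset S b & M \subset S b] /\
   [/\ #|T1| = 8 * m, #|T2| = 8 * m & 5 * m <= #|M|] /\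
   [/\ [disjoint T1 & T2], [disjoint T1 & M] & [disjoint T2 & M]].
  have [|T1 T1S cT1] := @exists_subset_card _ (S b) (8 * m).
    by apply: leq_trans (cS b); rewrite leq_mul2r orbT.
  have [|T2 T2S cT2] := @exists_subset_card _ (S b :\: T1) (8 * m).
    by rewrite cardsD (setIidPr T1S) cT1; move: (cS b); clear; lia.
  exists T1, T2, (S b :\: T1 :\: T2); split; split=> //.
  - exact: subset_trans T2S (subsetDl _ _).
  - by apply: subset_trans (subsetDl _ _) (subsetDl _ _).
  - split=> //; rewrite cardsD (setIidPr T2S) cardsD (setIidPr T1S) cT1 cT2.
    by move: (cS b); clear; lia.
  - split; rewrite disjoint_sym; last exact: disjoint_setDl.
      by apply: disjointWl T2S _; exact: disjoint_setDl.
    by apply: disjointWl (subsetDl _ _) _; exact: disjoint_setDl.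
have [T1t [T2t [Mt [[T1tS T2tS MtS] [[cT1t cT2t cMt] [t12 t1M t2M]]]]]] := splitS true.
have [T1f [T2f [Mf [[T1fS T2fS MfS] [[cT1f cT2f cMf] [f12 f1M f2M]]]]]] := splitS false.
pose T1 b := if b then T1t else T1f; pose T2 b := if b then T2t else T2f.
pose M b := if b then Mt else Mf.
have cross (A B : bool -> {set V}) : (forall b, A b \subset S b) -> (forall b, B b \subset S b) ->
    (forall b, [disjoint A b & B b]) -> [disjoint A true :|: A false & B true :|: B false].
  move=> AS BS dAB; rewrite disjoint_subset; apply/subsetP => x.
  have AB b b' : x \in A b -> x \notin B b'.
    case: (eqVneq b' b) => [->|nb] xA; first by rewrite (disjointFr (dAB b) xA).
    have -> : b' = ~~ b by move: nb; case: (b) (b') => [] [].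
    by apply: contra (Sdisj (subsetP (AS b) _ xA)) => /(subsetP (BS _)).
  by rewrite !inE negb_or => /orP[] xA; rewrite !(AB _ _ xA).
have T1S b : T1 b \subset S b by case: b.
have T2S b : T2 b \subset S b by case: b.
have [B1 [cB1 grow1]] := reservoir T1S (fun b => ltac:(by case: b; rewrite /= ?cT1t ?cT1f)) jm.
have [B2 [cB2 grow2]] := reservoir T2S (fun b => ltac:(by case: b; rewrite /= ?cT2t ?cT2f)) jm.
pose M' b := M b :\: B1 b :\: B2 b.
have M'M b : M' b \subset M b by apply: subset_trans (subsetDl _ _) (subsetDl _ _).
have M'S b : M' b \subset S b by apply: subset_trans (M'M b) _; case: b.
(* Removing two bad sets from [5 * m] vertices leaves [3 * m], enough for a path on [l.+1 <= m]
   vertices, that is, with [l] edges. *)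
have cM' b : 2 * m + l.+1 <= #|M' b|.
  have cM : 5 * m <= #|M b| by case: b.
  have s1 := subset_leq_card (subsetIr (M b) (B1 b)).
  have s2 := subset_leq_card (subsetIr (M b :\: B1 b) (B2 b)).
  rewrite /M' 2!cardsD; move: (cB1 b) (cB2 b) cM s1 s2 lm.
  clear; lia.
have [x [p [pp sp up pM]]] := long_path M'S cM' (ltn0Sn l).
have inM' z : z \in x :: p -> exists b, z \in M' b.
  by move=> /pM; rewrite in_setU => /orP[]; [exists true|exists false].
have [b xM'] := inM' x (mem_head _ _).
have [b' yM'] := inM' (last x p) (mem_last _ _).
have xS := subsetP (M'S b) _ xM'; have yS := subsetP (M'S b') _ yM'.
have b'E : b' = ~~ b.
  have := path_side xS pp; rewrite sp /= oddl addbT => lS.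
  have [//|nb] := eqVneq b' (~~ b).
  have E : b' = b by move: nb; case: (b) (b') => [] [].
  by have := Sdisj yS; rewrite E lS.
move: (xM') (yM'); rewrite !in_setD => /and3P[x2 x1 _] /and3P[y2 y1 _].
have [L1 [L1S cL1 reach1]] := grow1 _ _ xS x1.
have [L2 [L2S cL2 reach2]] := grow2 _ _ yS y2.
exists (~~ b (+) odd j), L1, L2; rewrite cL1 cL2; split=> //.
  by rewrite b'E negbK in L2S; rewrite addNb negbK.
move=> u v /reach1[p1 [pp1 lp1 sp1 up1 p1T]] /reach2[p2 [pp2 lp2 sp2 up2 p2T]].
have d12 : [disjoint p1 & p2].
  by apply: disjoint_seq_sub p1T p2T _; apply: cross => // -[].
have MS b0 : M b0 \subset S b0 by case: b0.
have pM2 : {subset x :: p <= M true :|: M false}.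
  by move=> z /inM'[[] /(subsetP (M'M _)) zM]; rewrite in_setU zM ?orbT.
have d1 : [disjoint p1 & x :: p].
  by apply: disjoint_seq_sub p1T pM2 _; apply: cross => // -[].
have d2 : [disjoint p2 & x :: p].
  by apply: disjoint_seq_sub p2T pM2 _; apply: cross => // -[].
(* The walk climbs the first tree from [u] to [x], follows [p], and descends the second tree to [v].
   The right-hand form shows its three disjoint pieces. *)
have E : u :: (rev (belast x p1) ++ p ++ p2) = rev p1 ++ (x :: p) ++ p2.
  rewrite -lp1 -[LHS]/((last x p1 :: rev (belast x p1)) ++ p ++ p2).
  by rewrite -rev_rcons -lastI rev_cons -cats1 -!catA.
exists (rev (belast x p1) ++ p ++ p2).
have lrev : last u (rev (belast x p1)) = x.
  by rewrite -lp1; case: (p1) => //= z p'; rewrite rev_cons last_rcons.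
rewrite E; split.
- rewrite cat_path lrev cat_path pp pp2 /= andbT -lp1 rev_path.
  by rewrite (eq_path (e' := r)) ?andbT // => a c /=; rewrite rsym.
- by rewrite !last_cat lrev.
- by rewrite !size_cat size_rev size_belast sp1 sp2 sp /=; clear; lia.
- rewrite cat_uniq [uniq (_ ++ p2)]cat_uniq rev_uniq up1 up up2 -!disjoint_has.
  rewrite d2 disjoint_cat !(eq_disjoint_r (mem_rev p1)) disjoint_sym d1.
  by rewrite disjoint_sym d12.
- have inS (A : bool -> {set V}) : (forall b, A b \subset S b) ->
      A true :|: A false \subset S true :|: S false by move=> AS; apply: setUSS.
  move=> z; rewrite !mem_cat mem_rev => /or3P[/p1T|/pM2|/p2T]; exact/subsetP/inS.
Qed.
End BipartiteLinking.

(** * Avoiding the colours one by one *)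

Lemma mono_cycle_of_seq (V : finType) (e : rel V) t (col : V -> V -> 'I_t) i (c : seq V) :
  c != [::] -> uniq c -> cycle [rel x y | e x y && (col x y == i)] c ->
  Defs.mono_cycle e col (size c) i.
Proof.
case: c => // x p _ up cyc; exists (fun j : 'I_(size (x :: p)) => nth x (x :: p) j); split.
  by move=> j k /eqP; rewrite nth_uniq // => /eqP /val_inj.
move=> j; have /(pathP x)/(_ j) := cyc; rewrite size_rcons ltn_ord => /(_ isT) /=.
rewrite -rcons_cons nth_rcons ltn_ord.
suff -> : nth x (rcons p x) j = nth x (x :: p) (ordS j) by case/andP => -> /eqP.
rewrite [RHS]/= nth_rcons; have := ltn_ord j; rewrite ltnS leq_eqVlt => /orP[/eqP jp|jp].
  by rewrite jp ltnn eqxx modnn.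
by rewrite jp modn_small ?ltnS.
Qed.

Lemma up_log2_bounds m : 0 < m -> m <= 2 ^ up_log 2 m <= 2 * m.
Proof.
case: m => [|[|m]] // _; have /andP[lo hi] := @up_log_bounds 2 m.+2 isT isT.
rewrite hi /=; case: (up_log _ _) lo => [|k] /= lo; first by rewrite expn0; lia.
by rewrite expnS leq_mul2l ltnW.
Qed.

(* [odd_factor k * m] vertices contain two [m]-sets with no edge of the [k] odd colours in between. *)
Fixpoint odd_factor k :=
  if k is k'.+1 then (if k' is 0 then 45 else 21 * odd_factor k' ^ 2) else 2.

Lemma odd_factor_gt1 k : 1 < odd_factor k.
Proof.
elim: k => [|[|k] IH] //; change (1 < 21 * odd_factor k.+1 ^ 2).
by move: (odd_factor _) IH => f; rewrite -mulnn; nia.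
Qed.

Section Colours.
Variables (V : finType) (e : rel V) (t : nat) (col : V -> V -> 'I_t) (ns : 'I_t -> nat).
Variables (n D : nat).
Hypothesis e_sym : forall x y, e x y = e y x.
Hypothesis col_sym : forall x y, col x y = col y x.
Hypothesis n_gt0 : 0 < n.
Hypothesis ns_le : forall i, ns i <= n.
Hypothesis ns_ge : forall i, 2 * D + 2 <= ns i.
Hypothesis cardV : #|V| <= 2 ^ D.
Hypothesis no_cycle : forall i, ~ Defs.mono_cycle e col (ns i) i.

Definition crel i : rel V := [rel x y | e x y && (col x y == i)].

Lemma crel_sym i : symmetric (crel i).
Proof. by move=> x y; rewrite /crel /= e_sym col_sym. Qed.

Definition colours_avoid (cs : seq 'I_t) (A B : {set V}) :=
  forall x y, x \in A -> y \in B -> e x y -> col x y \notin cs.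

Definition has_hole i m (A B : {set V}) := exists X Y : {set V},
  [/\ X \subset A, Y \subset B, m <= #|X|, m <= #|Y| & colours_avoid [:: i] X Y].

Lemma no_hole_edge i m (A B X Y : {set V}) : ~ has_hole i m A B -> X \subset A -> Y \subset B ->
  m <= #|X| -> m <= #|Y| -> exists x y, [/\ x \in X, y \in Y & crel i x y].
Proof.
move=> nh XA YB mX mY; apply: NNPP => nex; case: nh; exists X, Y; split=> // x y xX yY exy.
by rewrite inE; apply/negP => cxy; apply: nex; exists x, y; rewrite /crel /= exy cxy.
Qed.

(** The link is [b0.+1] edges shorter than the cycle: one closing edge for even length, two through
    an outside vertex for odd length. The side of the leaves depends on where the path starts, hence
    the choice of [(P, Q)]. *)
Lemma colour_link i m (A B : {set V}) (b0 : bool) :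
    [disjoint A & B] -> n <= m -> 21 * m <= #|A| -> 21 * m <= #|B| -> ~ has_hole i m A B ->
    odd (ns i) = b0 ->
  exists j l (P Q L1 L2 : {set V}), [/\ l + 2 * j.+1 + b0.+1 = ns i,
    (P, Q) = (A, B) \/ (P, Q) = (B, A), L1 \subset P /\ L2 \subset Q,
    m <= #|L1| /\ m <= #|L2| &
    forall u v, u \in L1 -> v \in L2 -> exists w,
       [/\ path (crel i) u w, last u w = v, size w = l + 2 * j.+1, uniq (u :: w) &
           {subset u :: w <= A :|: B}]].
Proof.
move=> dAB nm mA mB nh parity.
pose S (b : bool) := if b then A else B.
(* Only edges of colour [i] between [A] and [B] are kept, which makes the relation bipartite. *)
pose r : rel V := [rel x y | crel i x y && ((x \in A) && (y \in B) || (x \in B) && (y \in A))].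
have m_gt0 : 0 < m := leq_trans n_gt0 nm.
have rsym : symmetric r.
  by move=> x y; rewrite /r /= crel_sym orbC ![(y \in _) && _]andbC.
have Sdisj b x : x \in S b -> x \notin S (~~ b).
  by case: b => /= xS; rewrite ?(disjointFr dAB xS) ?(disjointFl dAB xS).
have rbip b x y : x \in S b -> r x y -> y \in S (~~ b).
  by rewrite /r /=; move=> xS; have := Sdisj _ _ xS;
    case: b xS => /= -> /negPf -> /andP[_]; rewrite ?orbF.
have rich b (X Y : {set V}) : X \subset S b -> Y \subset S (~~ b) ->
    m <= #|X| -> m <= #|Y| -> exists x y, [/\ x \in X, y \in Y & r x y].
  case: b => /= XS YS mX mY.
    have [x [y [xX yY cxy]]] := no_hole_edge nh XS YS mX mY; exists x, y; split=> //.
    by apply/andP; split; rewrite //= (subsetP XS _ xX) (subsetP YS _ yY).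
  have [x [y [xX yY cxy]]] := no_hole_edge nh YS XS mY mX; exists y, x; split=> //.
  apply/andP; split; first by rewrite crel_sym.
  by rewrite /= (subsetP XS _ yY) (subsetP YS _ xX) orbT.
have /andP[mj jm] := up_log2_bounds m_gt0; set j := up_log 2 m in mj jm.
(* Here [2 ^ (j + 3) <= 16 * m < 21 * m <= #|V| <= 2 ^ D]. With [2 * D + 2 <= ns i] this keeps the
   subtraction defining [l] from truncating. *)
have jD : j + 3 < D.
  rewrite -(ltn_exp2l _ _ (isT : 1 < 2)) expnD.
  have := leq_trans mA (leq_trans (max_card _) cardV); move: jm m_gt0; clear; lia.
pose l := ns i - 2 * j.+1 - b0.+1.
have lE : l + 2 * j.+1 + b0.+1 = ns i.
  by move: (ns_ge i) jD; rewrite /l; clear; case: (b0); lia.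
have oddl : odd l.
  by have := congr1 odd lE; rewrite !oddD mul2n odd_double parity; case: (b0) => /=; case: (odd l).
have lm : l.+1 <= m.
  by apply: leq_trans nm; apply: leq_trans (ns_le i); rewrite -lE; clear; lia.
have cS b : 21 * m <= #|S b| by case: b.
have [b [L1 [L2 [L1S L2S mL1 mL2 link]]]] :=
  linked_leaves rsym Sdisj rbip m_gt0 rich cS mj jm oddl lm.
exists j, l, (S b), (S (~~ b)), L1, L2; split=> //.
  by case: (b); [left|right].
move=> u v uL vL; have [w [pw lw sw uw wS]] := link u v uL vL.
exists w; split=> //; apply: sub_path pw => x y; by case/andP.
Qed.

Lemma even_hole i m (A B : {set V}) : ~~ odd (ns i) ->
    [disjoint A & B] -> n <= m -> 21 * m <= #|A| -> 21 * m <= #|B| -> has_hole i m A B.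
Proof.
move=> /negPf ev dAB nm mA mB; apply: NNPP => nh.
have [j [l [P [Q [L1 [L2 [lE PQ [L1P L2Q] [mL1 mL2] link]]]]]]] :=
  colour_link dAB nm mA mB nh ev.
have [u [v [uL vL cuv]]] : exists u v, [/\ u \in L1, v \in L2 & crel i u v].
  case: PQ => -[PE QE]; rewrite PE QE in L1P L2Q.
    exact: no_hole_edge nh L1P L2Q mL1 mL2.
  have [x [y [xX yY cxy]]] := no_hole_edge nh L2Q L1P mL2 mL1.
  by exists y, x; rewrite crel_sym.
have [w [pw lw sw uw _]] := link u v uL vL.
apply: (@no_cycle i); rewrite -lE -sw addn1.
apply: (@mono_cycle_of_seq _ _ _ _ _ (u :: w)) => //.
by rewrite /= rcons_path pw lw -/(crel i v u) crel_sym.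
Qed.

Lemma odd_hole i m (A B C : {set V}) : odd (ns i) ->
    [disjoint A & B] -> [disjoint A & C] -> [disjoint B & C] -> n <= m ->
    21 * m <= #|A| -> 21 * m <= #|B| -> 3 * m <= #|C| ->
  [\/ has_hole i m A B, has_hole i m A C | has_hole i m B C].
Proof.
move=> od dAB dAC dBC nm mA mB mC; apply: NNPP => nh.
have nAB : ~ has_hole i m A B by move=> ?; apply: nh; constructor 1.
have nAC : ~ has_hole i m A C by move=> ?; apply: nh; constructor 2.
have nBC : ~ has_hole i m B C by move=> ?; apply: nh; constructor 3.
have [j [l [P [Q [L1 [L2 [lE PQ [L1P L2Q] [mL1 mL2] link]]]]]]] :=
  colour_link dAB nm mA mB nAB od.
have few (L P' : {set V}) : ~ has_hole i m P' C -> L \subset P' -> m <= #|L| ->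
    #|C :\: nbrs (crel i) L| < m.
  move=> nP LP mL; rewrite ltnNge; apply/negP => mD.
  have [x [y [xL]]] := no_hole_edge nP LP (subsetDl _ _) mL mD.
  by rewrite in_setD => /andP[/negP yN _] cxy; apply: yN; apply/nbrsP; exists x.
have [few1 few2] : #|C :\: nbrs (crel i) L1| < m /\ #|C :\: nbrs (crel i) L2| < m.
  by case: PQ => -[PE QE]; rewrite PE QE in L1P L2Q; split;
    [apply: few L1P mL1|apply: few L2Q mL2|apply: few L1P mL1|apply: few L2Q mL2].
(* [L1] and [L2] each miss fewer than [m] of the [3 * m] vertices of [C], so a common neighbour is
   left; lying outside [A] and [B], it is not on the link. *)
have [z zC] : exists z, z \in C :&: nbrs (crel i) L1 :&: nbrs (crel i) L2.
  apply/card_gt0P; have m_gt0 : 0 < m := leq_trans n_gt0 nm.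
  have := cardsID (nbrs (crel i) L1) C.
  have := cardsID (nbrs (crel i) L2) (C :&: nbrs (crel i) L1).
  have : #|C :&: nbrs (crel i) L1 :\: nbrs (crel i) L2| <= #|C :\: nbrs (crel i) L2|.
    by apply/subset_leq_card/setSD/subsetIl.
  by move: few1 few2 mC m_gt0; clear; lia.
move: zC; rewrite !in_setI => /andP[/andP[zC /nbrsP[u uL cuz]] /nbrsP[v vL cvz]].
have [w [pw lw sw uw wAB]] := link u v uL vL.
apply: (@no_cycle i); rewrite -lE -sw addn2.
apply: (@mono_cycle_of_seq _ _ _ _ _ (z :: u :: w)) => //.
  rewrite cons_uniq uw andbT; apply/negP => /wAB; rewrite in_setU.
  by rewrite (disjointFl dAC zC) (disjointFl dBC zC).
change (crel i z u && path (crel i) u (rcons w z)).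
by rewrite rcons_path pw lw cvz crel_sym cuz.
Qed.

Lemma colours_avoid_cons i cs (A B X Y : {set V}) : X \subset A -> Y \subset B ->
  colours_avoid cs A B -> colours_avoid [:: i] X Y -> colours_avoid (i :: cs) X Y.
Proof.
move=> XA YB av1 av2 x y xX yY exy; have := av2 _ _ xX yY exy; rewrite !inE negb_or => -> /=.
by apply: av1 => //; [exact: (subsetP XA)|exact: (subsetP YB)].
Qed.

Lemma odd_step i cs m (A B C S : {set V}) : odd (ns i) -> n <= m ->
    A \subset S -> B \subset S -> C \subset S ->
    [disjoint A & B] -> [disjoint A & C] -> [disjoint B & C] ->
    21 * m <= #|A| -> 21 * m <= #|B| -> 3 * m <= #|C| ->
    colours_avoid cs A B -> colours_avoid cs A C -> colours_avoid cs B C ->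
  exists X Y : {set V}, [/\ X \subset S, Y \subset S, [disjoint X & Y], m <= #|X| /\ m <= #|Y| &
    colours_avoid (i :: cs) X Y].
Proof.
move=> od nm AS BS CS dAB dAC dBC mA mB mC aAB aAC aBC.
have fin (P Q : {set V}) : P \subset S -> Q \subset S -> [disjoint P & Q] ->
    colours_avoid cs P Q -> has_hole i m P Q -> exists X Y : {set V},
    [/\ X \subset S, Y \subset S, [disjoint X & Y], m <= #|X| /\ m <= #|Y| &
    colours_avoid (i :: cs) X Y].
  move=> PS QS dPQ aPQ [X [Y [XP YQ mX mY av]]]; exists X, Y; split=> //.
  - exact: subset_trans XP PS.
  - exact: subset_trans YQ QS.
  - exact: disjointW XP YQ dPQ.
  - exact: colours_avoid_cons XP YQ aPQ av.
by case: (odd_hole od dAB dAC dBC nm mA mB mC); apply: fin.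
Qed.

Lemma colours_avoid_sub cs (A B X Y : {set V}) : X \subset A -> Y \subset B ->
  colours_avoid cs A B -> colours_avoid cs X Y.
Proof. by move=> XA YB av x y xX yY; apply: av; [exact: (subsetP XA)|exact: (subsetP YB)]. Qed.

Lemma split_set m1 m2 (S : {set V}) : m1 + m2 <= #|S| -> exists A B : {set V},
  [/\ A \subset S, B \subset S, [disjoint A & B], m1 <= #|A| & m2 <= #|B|].
Proof.
move=> mS; have [|A AS cA] := @exists_subset_card _ S m1; first by move: mS; clear; lia.
exists A, (S :\: A); split; rewrite ?subsetDl ?cA //.
  by rewrite disjoint_sym disjoint_setDl.
by rewrite cardsD (setIidPr AS) cA; move: mS; clear; lia.
Qed.

Lemma odd_stage (cs : seq 'I_t) : all (fun i => odd (ns i)) cs ->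
  forall m (S : {set V}), n <= m -> odd_factor (size cs) * m <= #|S| ->
  exists X Y : {set V}, [/\ X \subset S, Y \subset S, [disjoint X & Y], m <= #|X| /\ m <= #|Y| &
    colours_avoid cs X Y].
Proof.
elim: cs => [_|i cs IH /= /andP[oi ocs]] m S nm mS.
  have [|X [Y [XS YS dXY mX mY]]] := @split_set m m S; first by move: mS => /=; clear; lia.
  by exists X, Y.
have {}IH := IH ocs; case: cs ocs IH mS => [_ _|i' cs ocs IH] mS.
  (* For a single odd colour the demand is 45 = 21 + 21 + 3, the sizes required by [odd_hole]. *)
  have [|A [S' [AS S'S dAS' mA mS']]] := @split_set (21 * m) (24 * m) S.
    by move: mS => /=; clear; lia.
  have [|B [C [BS' CS' dBC mB mC]]] := @split_set (21 * m) (3 * m) S'.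
    by move: mS'; clear; lia.
  have dAB := disjointWr BS' dAS'; have dAC := disjointWr CS' dAS'.
  by apply: (@odd_step i [::] m A B C S) => //; apply: subset_trans S'S.
set k := size (i' :: cs) in IH mS; have fk : 0 < odd_factor k := ltnW (odd_factor_gt1 k).
(* The first application makes [A] large enough for a second one inside it. The halves [A1], [A2] of
   [A] avoid [cs] between each other, and both avoid it towards [B], which serves as the third
   set. *)
have [||A [B [AS BS dAB [mA mB] avAB]]] := IH (odd_factor k * (21 * m)) S.
- by apply: leq_trans nm _; rewrite -{1}[m]mul1n mulnA leq_mul2r muln_gt0 fk orbT.
- apply: leq_trans mS; change (odd_factor k * (odd_factor k * (21 * m)) <=
    21 * odd_factor k ^ 2 * m); rewrite -mulnn; clear; lia.
have [||A1 [A2 [A1A A2A dA [mA1 mA2] avA]]] := IH (21 * m) A => //.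
- by apply: leq_trans nm _; rewrite leq_pmull.
apply: (@odd_step i (i' :: cs) m A1 A2 B S) => //.
- exact: subset_trans A1A AS.
- exact: subset_trans A2A AS.
- exact: disjointWl A1A dAB.
- exact: disjointWl A2A dAB.
- apply: leq_trans mB; move: fk; clear; nia.
- exact: colours_avoid_sub A1A (subxx _) avAB.
- exact: colours_avoid_sub A2A (subxx _) avAB.
Qed.

Lemma even_stage (es cs : seq 'I_t) m (A B : {set V}) : all (fun i => ~~ odd (ns i)) es ->
    n <= m -> [disjoint A & B] -> 21 ^ size es * m <= #|A| -> 21 ^ size es * m <= #|B| ->
    colours_avoid cs A B ->
  exists X Y : {set V}, [/\ X \subset A, Y \subset B, m <= #|X|, m <= #|Y| &
    colours_avoid (es ++ cs) X Y].
Proof.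
move=> + nm; elim: es A B => [|i es IH] A B /=.
  by rewrite !mul1n => _ dAB mA mB av; exists A, B.
case/andP => ei ees dAB; rewrite !expnS -!mulnA => mA mB av.
have nm' : n <= 21 ^ size es * m.
  by apply: leq_trans nm _; rewrite leq_pmull // expn_gt0.
have [X [Y [XA YB mX mY avi]]] := even_hole ei dAB nm' mA mB.
have [X' [Y' [X'X Y'Y mX' mY' av']]] :=
  IH X Y ees (disjointW XA YB dAB) mX mY (colours_avoid_sub XA YB av).
exists X', Y'; split=> //.
- exact: subset_trans X'X XA.
- exact: subset_trans Y'Y YB.
- exact: colours_avoid_cons (subxx _) (subxx _) av' (colours_avoid_sub X'X Y'Y avi).
Qed.
End Colours.

Lemma hole_free_arrows (V : finType) (e : rel V) t (ns : 'I_t -> nat) n D :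
    simple_graph e -> 0 < n -> (forall i, ns i <= n) -> (forall i, 2 * D + 2 <= ns i) ->
    #|V| <= 2 ^ D -> odd_factor (num_odd ns) * 21 ^ num_even ns * n <= #|V| ->
    (forall X Y : {set V}, [disjoint X & Y] -> n <= #|X| -> n <= #|Y| ->
       exists x y, [/\ x \in X, y \in Y & e x y]) ->
  arrows_cycles e ns.
Proof.
move=> [e_sym _] n_gt0 ns_le ns_ge cV FV hfree col col_sym; apply: NNPP => nc.
have no_cycle i : ~ Defs.mono_cycle e col (ns i) i by move=> ?; apply: nc; exists i.
pose os := enum [set i | odd (ns i)]; pose es := enum [set i | ~~ odd (ns i)].
have oddos : all (fun i => odd (ns i)) os by apply/allP => i; rewrite mem_enum inE.
have evenes : all (fun i => ~~ odd (ns i)) es by apply/allP => i; rewrite mem_enum inE.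
have szos : size os = num_odd ns by rewrite -cardE.
have szes : size es = num_even ns by rewrite -cardE.
(* The odd colours come first and leave sets with a spare factor 21 for every even colour. *)
have [||A [B [_ _ dAB [mA mB] av]]] :=
  odd_stage e_sym col_sym n_gt0 ns_le ns_ge cV no_cycle oddos
    (m := 21 ^ num_even ns * n) (S := [set: V]).
- by rewrite leq_pmull // expn_gt0.
- by rewrite szos mulnA cardsT.
rewrite -szes in mA mB.
have [X [Y [XA YB mX mY avXY]]] :=
  even_stage e_sym col_sym n_gt0 ns_le ns_ge cV no_cycle evenes (leqnn n) dAB mA mB av.
have [x [y [xX yY exy]]] := hfree X Y (disjointW XA YB dAB) mX mY.
by have := avXY x y xX yY exy; rewrite mem_cat !mem_enum !inE; case: odd.
Qed.

(** * Sparse graphs without large holes *)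

Section Greedy.
Variables (V : finType) (F n : nat).
Hypothesis n_gt0 : 0 < n.
Hypothesis F_gt0 : 0 < F.
Hypothesis cardV : #|V| = F * n.

(** Averaging: each member of [R] contains [n ^ 2] of the [F ^ 2 * n ^ 2] pairs of vertices, so some
    pair lies in at least a proportion [1 / F ^ 2] of the members. *)
Lemma popular_pair (R : {set {set V} * {set V}}) :
    (forall XY, XY \in R -> #|XY.1| = n /\ #|XY.2| = n) ->
  exists u v, #|R| <= F ^ 2 * #|[set XY in R | (u \in XY.1) && (v \in XY.2)]|.
Proof.
move=> Rn; pose h (uv : V * V) := #|[set XY in R | (uv.1 \in XY.1) && (uv.2 \in XY.2)]|.
have [/existsP[[u v] uvR]|/existsPn small] := boolP [exists uv, #|R| <= F ^ 2 * h uv].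
  by exists u, v.
have : \sum_uv (F ^ 2 * h uv + 1) <= \sum_(uv : V * V) #|R|.
  by apply: leq_sum => uv _; rewrite addn1 ltnNge small.
rewrite big_split /= -big_distrr /= !sum_nat_const card_prod cardV muln1.
suff -> : \sum_uv h uv = #|R| * (n * n).
  by move: n_gt0 F_gt0; clear; rewrite -mulnn; set r := #|R|; nia.
transitivity (\sum_(uv : V * V) \sum_(XY in R) ((uv.1 \in XY.1) && (uv.2 \in XY.2) : nat)).
  apply: eq_bigr => uv _; rewrite /h -sum1_card [RHS]big_mkcond [LHS]big_mkcond /=.
  by apply: eq_bigr => XY _; rewrite !inE; case: (XY \in R) => //=; case: (_ && _).
rewrite exchange_big /= -sum_nat_const; apply: eq_bigr => -[X Y] /Rn[/= cX cY].
rewrite -{1}cX -cY -cardsX -sum1_card [RHS]big_mkcond /=.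
by apply: eq_bigr => -[u v] _; rewrite in_setX /=; case: (_ && _).
Qed.

(** The two sets may overlap, so the count starts from the square of one binomial coefficient. *)
Definition missed (E : seq (V * V)) : {set {set V} * {set V}} :=
  [set XY : {set V} * {set V} | [&& #|XY.1| == n, #|XY.2| == n &
             all (fun uv => ~~ ((uv.1 \in XY.1) && (uv.2 \in XY.2))) E]].

(** Every new popular pair multiplies the number of survivors by at most [1 - 1 / F ^ 2];
    denominators are cleared to stay in the natural numbers. *)
Lemma greedy_pairs q : exists E, size E = q /\
  #|missed E| * (F ^ 2) ^ q <= 'C(F * n, n) ^ 2 * (F ^ 2 - 1) ^ q.
Proof.
elim: q => [|q [E [szE IH]]].
  exists [::]; rewrite !expn0 !muln1; split=> //.
  rewrite -mulnn -cardV -card_draws -cardsX; apply: subset_leq_card.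
  by apply/subsetP => XY; rewrite !inE /= andbT.
have [XY|u [v huv]] := @popular_pair (missed E).
  by rewrite inE => /and3P[/eqP-> /eqP->].
exists ((u, v) :: E); rewrite /= szE; split=> //.
set H := [set XY in missed E | _] in huv.
have cM : #|missed ((u, v) :: E)| + #|H| = #|missed E|.
  rewrite addnC -(cardsID [set XY : {set V} * {set V} | (u \in XY.1) && (v \in XY.2)] (missed E)); congr (_ + _).
    by apply: eq_card => XY; rewrite !inE.
  by apply: eq_card => XY; rewrite !inE /=; case: (_ == n); case: (_ == n); rewrite ?andbF.
have step : #|missed ((u, v) :: E)| * F ^ 2 <= #|missed E| * (F ^ 2 - 1).
  by rewrite mulnBr -cM mulnDl muln1; move: huv; rewrite -cM; clear; lia.
rewrite [(F ^ 2) ^ q.+1]expnS [(F ^ 2 - 1) ^ q.+1]expnS mulnA.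
apply: leq_trans (leq_mul step (leqnn _)) _.
by rewrite mulnAC [X in _ <= X]mulnCA mulnC leq_mul2l IH orbT.
Qed.

Lemma sparse_hole_free_graph q : 'C(F * n, n) ^ 2 * (F ^ 2 - 1) ^ q < (F ^ 2) ^ q ->
  exists e : rel V, [/\ simple_graph e, num_edges e <= q &
    forall X Y : {set V}, [disjoint X & Y] -> n <= #|X| -> n <= #|Y| ->
      exists x y, [/\ x \in X, y \in Y & e x y]].
Proof.
move=> small; have [E [szE missE]] := greedy_pairs q.
have noneE : missed E = set0.
  apply/eqP; rewrite -cards_eq0 -leqn0 leqNgt; apply/negP => pos.
  by move: (leq_trans small (leq_trans (leq_pmull _ pos) missE)); rewrite ltnn.
exists [rel u v | (u != v) && (((u, v) \in E) || ((v, u) \in E))]; split.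
- by split=> [x y|x] /=; rewrite ?eqxx // eq_sym orbC.
- rewrite -szE -(size_map (fun uv : V * V => [set uv.1; uv.2])).
  apply: leq_trans (card_size _); apply: subset_leq_card.
  apply/subsetP => A /imset2P[x y _]; rewrite inE /= => /andP[_ xy] ->.
  apply/mapP; case/orP: xy => xyE; first by exists (x, y).
  by exists (y, x); rewrite //= setUC.
- move=> X Y dXY nX nY.
  have [X' X'X cX'] := exists_subset_card nX; have [Y' Y'Y cY'] := exists_subset_card nY.
  have : (X', Y') \notin missed E by rewrite noneE inE.
  rewrite inE /= cX' cY' eqxx /= => /allPn[[u v] uvE]; rewrite negbK /= => /andP[uX vY].
  have {}uX := subsetP X'X _ uX; have {}vY := subsetP Y'Y _ vY.
  exists u, v; rewrite /= uvE andbT; split=> //.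
  by apply/eqP => uv; rewrite -uv (disjointFr dXY uX) in vY.
Qed.
End Greedy.

(** * Real estimates for the number of greedy steps *)

Local Open Scope R_scope.

Lemma INR_expn a b : INR (a ^ b)%N = INR a ^ b.
Proof. by elim: b => //= b IH; rewrite expnS mult_INR IH. Qed.

Lemma exp_natmul (x : R) k : exp (INR k * x) = exp x ^ k.
Proof.
elim: k => [|k IH]; first by rewrite /= Rmult_0_l exp_0.
by rewrite S_INR Rmult_plus_distr_r Rmult_1_l exp_plus IH /= Rmult_comm.
Qed.

Lemma exp_le_mono x y : x <= y -> exp x <= exp y.
Proof. by case=> [/exp_increasing/Rlt_le|->] //; exact: Rle_refl. Qed.

Lemma ln_le_mono x y : 0 < x -> x <= y -> ln x <= ln y.
Proof. by move=> x0 [/(ln_increasing _ _ x0)/Rlt_le|->] //; exact: Rle_refl. Qed.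

(** The weak Stirling bound, by induction from [(1 + 1 / n) ^ n <= exp 1]. *)
Lemma pow_le_fact_exp n : INR n ^ n <= INR n`! * exp (INR n).
Proof.
elim: n => [|n IH]; first by rewrite /= exp_0; lra.
rewrite factS mult_INR S_INR exp_plus -tech_pow_Rmult.
have n0 := pos_INR n.
suff H : (INR n + 1) ^ n <= INR n ^ n * exp 1.
  have e1 := exp_pos 1; have := Rmult_le_compat_r _ _ _ (Rlt_le _ _ e1) IH.
  move=> H2; rewrite Rmult_assoc; apply: Rmult_le_compat_l; lra.
case: n {IH} n0 => [|n] n0; first by rewrite /=; have := exp_ineq1_le 1; lra.
have npos : 0 < INR n.+1 by apply: lt_0_INR; lia.
have E : INR n.+1 + 1 <= INR n.+1 * exp (/ INR n.+1).
  have := exp_ineq1_le (/ INR n.+1) => H.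
  have := Rmult_le_compat_l _ _ _ n0 H; rewrite Rmult_plus_distr_l Rinv_r; lra.
apply: Rle_trans (pow_incr _ _ n.+1 (conj _ E)) _; first lra.
by rewrite Rpow_mult_distr -exp_natmul Rinv_r; lra.
Qed.

Lemma ffact_leq_exp N k : (N ^_ k <= N ^ k)%N.
Proof.
elim: k N => [|k IH] [|N] //; rewrite ffactSS expnS leq_mul2l /=.
by apply: leq_trans (IH N) _; case: (k) => [|k'] //; rewrite leq_exp2r.
Qed.

(** The binomial coefficient is at most [(F * n) ^ n / n!], and the weak Stirling bound turns this
    into the [n]-th power of [F * exp 1]. *)
Lemma bin_le_exp F n : (0 < F)%N -> INR 'C(F * n, n) <= exp (INR n * (ln (INR F) + 1)).
Proof.
move=> F0; have Fpos : 0 < INR F by apply: lt_0_INR; lia.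
have fpos : 0 < INR n`! by apply: lt_0_INR; have := fact_gt0 n; lia.
rewrite Rmult_plus_distr_l Rmult_1_r exp_plus exp_natmul exp_ln //.
apply: (Rmult_le_reg_r _ _ _ fpos); rewrite -mult_INR.
have -> : ('C(F * n, n) * n`!)%coq_nat = ((F * n) ^_ n)%N by rewrite -bin_ffact.
have : INR ((F * n) ^_ n) <= INR ((F * n) ^ n)%N by apply: le_INR; have := ffact_leq_exp (F * n) n; lia.
rewrite INR_expn mult_INR Rpow_mult_distr => H; apply: Rle_trans H _.
rewrite Rmult_assoc; apply: Rmult_le_compat_l; first by apply: pow_le; lra.
by rewrite Rmult_comm; exact: pow_le_fact_exp.
Qed.

(** Since [(1 - 1 / F ^ 2) ^ q <= exp (- q / F ^ 2)], it suffices that [q / F ^ 2] exceeds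
    [2 * n * (ln F + 1)], the logarithm of the bound on the initial count. *)
Lemma hole_count F n q : (0 < F)%N ->
    2 * INR F ^ 2 * (ln (INR F) + 1) * INR n < INR q ->
  ('C(F * n, n) ^ 2 * (F ^ 2 - 1) ^ q < (F ^ 2) ^ q)%N.
Proof.
move=> F0 qbig; have Fpos : 0 < INR F by apply: lt_0_INR; lia.
have F2 : 0 < INR F ^ 2 by apply: pow_lt.
apply/ltP/INR_lt; rewrite mult_INR !INR_expn.
have -> : INR (F ^ 2 - 1) = INR F ^ 2 - 1.
  by rewrite minus_INR ?INR_expn //; apply/leP; rewrite expn_gt0 F0.
have B : INR 'C(F * n, n) ^ 2 <= exp (2 * (INR n * (ln (INR F) + 1))).
  rewrite -[2]/(INR 2) exp_natmul; apply: pow_incr; split; first exact: pos_INR.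
  exact: bin_le_exp.
have G : (INR F ^ 2 - 1) ^ q <= (INR F ^ 2) ^ q * exp (- (INR q / INR F ^ 2)).
  have -> : - (INR q / INR F ^ 2) = INR q * - / INR F ^ 2 by field; lra.
  rewrite exp_natmul -Rpow_mult_distr; apply: pow_incr; split.
    have : 1 <= INR F by rewrite -[1]/(INR 1); apply: le_INR; lia.
    by move=> ?; nra.
  have := Rmult_le_compat_l _ _ _ (Rlt_le _ _ F2) (exp_ineq1_le (- / INR F ^ 2)).
  by rewrite Rmult_plus_distr_l Ropp_mult_distr_r_reverse Rinv_r; lra.
have Fq : 0 < (INR F ^ 2) ^ q by apply: pow_lt.
have C0 : 0 <= INR 'C(F * n, n) ^ 2 by apply: pow_le; exact: pos_INR.
apply: (Rle_lt_trans _ (exp (2 * (INR n * (ln (INR F) + 1))) *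
   ((INR F ^ 2) ^ q * exp (- (INR q / INR F ^ 2))))).
  apply: Rle_trans (Rmult_le_compat_l _ _ _ C0 G) _; apply: Rmult_le_compat_r B.
  by apply: Rmult_le_pos; [lra|apply/Rlt_le/exp_pos].
rewrite (Rmult_comm (exp _)) Rmult_assoc -exp_plus -[X in _ < X]Rmult_1_r.
apply: Rmult_lt_compat_l => //; rewrite -[X in _ < X]exp_0; apply: exp_increasing.
suff : 2 * (INR n * (ln (INR F) + 1)) < INR q / INR F ^ 2 by lra.
apply: (Rmult_lt_reg_r _ _ _ F2).
have -> : INR q / INR F ^ 2 * INR F ^ 2 = INR q by field; lra.
lra.
Qed.

(** * Comparison with the constant [c] and the final bound *)

(** The margin 3/2 later pays for the factor 2 in the edge count. If [g] is 3/2 of the factor, the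
    recursion reads [g' = 14 * g ^ 2], while the right side is squared and multiplied by
    [35 ^ 2 / 82 > 14]; the base case is 67.5 against 82. *)
Lemma odd_factor_le k : 3 / 2 * INR (odd_factor k.+1) <= 82 * 35 ^ (2 ^ k.+1 - 2)%N.
Proof.
elim: k => [|k IH]; first by rewrite expn1 subnn /=; lra.
have -> : (2 ^ k.+2 - 2 = (2 ^ k.+1 - 2) + (2 ^ k.+1 - 2) + 2)%N.
  by rewrite [in LHS]expnS; have := ltn_expl k.+1 (isT : (1 < 2)%N); clear; lia.
rewrite -[odd_factor _]/(21 * odd_factor k.+1 ^ 2)%N mult_INR INR_expn !pow_add.
move: IH (pos_INR (odd_factor k.+1)).
set f := INR (odd_factor _); set p := 35 ^ _ => IH f0.
have -> : INR 21 = 21 by rewrite /=; lra.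
nra.
Qed.

Lemma const_c_ge t (ns : 'I_t -> nat) : (0 < t)%N ->
  3 / 2 * INR (odd_factor (num_odd ns) * 21 ^ num_even ns) <= const_c ns.
Proof.
move=> t_gt0; have E : (num_odd ns + num_even ns = t)%N.
  rewrite /num_odd /num_even -[RHS]card_ord -cardsT -(cardsID [set i | odd (ns i)] setT).
  by congr (_ + _)%N; apply: eq_card => i; rewrite !inE ?andbT.
have p21 k : 0 < 21 ^ k <= 81 ^ k by split; [apply: pow_lt|apply: pow_incr]; lra.
rewrite mult_INR INR_expn /const_c; have -> : INR 21 = 21 by rewrite /=; lra.
case: (num_odd ns) E => [|k] E.
  rewrite expn0 -[Z.sub _ _]/(-1)%Z -[odd_factor 0]/2%N.
  have -> : powerRZ 35 (-1) = / 35 by rewrite /= Rmult_1_r.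
  (* Without odd colours the comparison is 3 against 82/35, which fails by itself; since [0 < t]
     there is an even colour, and its factor 81 against 21 restores the inequality. *)
  case: (num_even ns) E => [|j] E; first by rewrite -E in t_gt0.
  by have := p21 j; rewrite -!tech_pow_Rmult -[INR 2]/2; lra.
have -> : Z.sub (Z.of_nat (2 ^ k.+1)) 2 = Z.of_nat (2 ^ k.+1 - 2)%N.
  by have := ltn_expl k.+1 (isT : (1 < 2)%N); clear; lia.
rewrite -pow_powerRZ; have := odd_factor_le k; have := pos_INR (odd_factor k.+1).
move: (p21 (num_even ns)); set f := INR _; set p := 35 ^ _ => -[a b] f0 H.
rewrite -Rmult_assoc; apply: Rmult_le_compat; lra.
Qed.

Theorem theorem1p1 :
  forall t : nat, (0 < t)%N ->
  exists N0 : nat,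
  forall ns : 'I_t -> nat,
    (forall i, (N0 <= ns i)%N) ->
    (forall i, Rge (INR (ns i))
       (Rplus (Rmult (IZR 2) (IZR (Rceil (Rlog2 (Rmult (INR (max_n ns)) (const_c ns))))))
              (IZR 2))) ->
    size_ramsey_cycles_le ns
      (Rmult (Rmult (Rplus (ln (const_c ns)) (IZR 1)) (pow (const_c ns) 2))
             (INR (max_n ns))).
Proof.
move=> t t_gt0; exists 1%N => ns ns_gt0 ns_ge.
have Fc := const_c_ge ns t_gt0.
set c := const_c ns in ns_ge Fc *; set n := max_n ns in ns_ge *.
set F := (odd_factor (num_odd ns) * 21 ^ num_even ns)%N in Fc.
have ns_le i : (ns i <= n)%N by exact: leq_bigmax.
have n_gt0 : (0 < n)%N := leq_trans (ns_gt0 (Ordinal t_gt0)) (ns_le _).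
have F_gt1 : (1 < F)%N.
  by apply: leq_trans (odd_factor_gt1 _) (leq_pmulr _ _); rewrite expn_gt0.
have n1 : 1 <= INR n by rewrite -[1]/(INR 1); apply: le_INR; lia.
have F2 : 2 <= INR F by rewrite -[2]/(INR 2); apply: le_INR; lia.
have ln2 : 0 < ln 2 by have := ln_lt_2; lra.
have lnF : 0 <= ln (INR F) by rewrite -ln_1; apply: ln_le_mono; lra.
have lnc : ln (INR F) <= ln c by apply: ln_le_mono; lra.
have nc1 : 1 <= INR n * c by nra.
pose x := Rlog2 (INR n * c); pose D := Z.to_nat (Rceil x).
have x0 : 0 <= x.
  by apply: Rmult_le_pos; [rewrite -ln_1; apply: ln_le_mono; lra|apply/Rlt_le/Rinv_0_lt_compat].
have xceil : x <= IZR (Rceil x).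
  by rewrite /Rceil opp_IZR; have [] := base_Int_part (- x); lra.
have DE : INR D = IZR (Rceil x).
  by rewrite INR_IZR_INZ Z2Nat.id //; apply: le_IZR; lra.
have ns_geD i : (2 * D + 2 <= ns i)%N.
  apply/leP/INR_le; rewrite plus_INR mult_INR DE -[INR 2]/2.
  by have := ns_ge i; rewrite -/x; lra.
(* [D] is the ceiling of the binary logarithm of [n * c], and [F <= c]. *)
have cardD : (F * n <= 2 ^ D)%N.
  apply/leP/INR_le; rewrite mult_INR INR_expn -[INR 2]/2 -[X in X ^ D]exp_ln; last lra.
  rewrite -exp_natmul; apply: (Rle_trans _ (INR n * c)); first by nra.
  rewrite -[X in X <= _]exp_ln; last lra.
  have -> : ln (INR n * c) = x * ln 2 by rewrite /x /Rlog2; field; lra.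
  by apply: exp_le_mono; apply: Rmult_le_compat_r; lra.
pose X := INR F ^ 2 * (ln (INR F) + 1) * INR n.
(* This absorbs the rounding: [q <= 2 * X + 1 <= 9 / 4 * X]. The constant 9/4 is the square of the
   margin 3/2 between [F] and [c]. *)
have X4 : 4 <= X.
  have a : 4 <= INR F ^ 2 by nra.
  have b : 4 <= INR F ^ 2 * (ln (INR F) + 1) by nra.
  by rewrite /X; nra.
pose q := Z.to_nat (up (2 * X)).
have [up1 up2] := archimed (2 * X).
have qE : INR q = IZR (up (2 * X)).
  by rewrite INR_IZR_INZ Z2Nat.id //; apply: le_IZR; lra.
have [e [simple_e num_e hole_free]] :
    exists e : rel 'I_(F * n), [/\ simple_graph e, (num_edges e <= q)%N &
      forall A B : {set 'I_(F * n)}, [disjoint A & B] -> (n <= #|A|)%N -> (n <= #|B|)%N ->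
        exists x y, [/\ x \in A, y \in B & e x y]].
  apply: (@sparse_hole_free_graph _ F) => //; first by lia.
    exact: card_ord.
  by apply: hole_count; [lia|rewrite qE; move: up1; rewrite /X; lra].
exists 'I_(F * n), e; split=> //; split.
  by apply: (hole_free_arrows simple_e n_gt0 ns_le ns_geD); rewrite ?card_ord.
apply: (Rle_trans _ (INR q)); first by apply: le_INR; apply/leP.
rewrite qE; apply: (Rle_trans _ (9 / 4 * X)); first lra.
have c2 : 9 / 4 * INR F ^ 2 <= c ^ 2 by nra.
rewrite /X -Rmult_assoc; apply: Rmult_le_compat_r; first lra.
rewrite -Rmult_assoc Rmult_comm; apply: Rmult_le_compat; lra || nra.
Qed.
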